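(* Let $S\subset\mathbb{Z}_+$ be a proper cofinite set of positive integers, $f(x)=1-\sum_{k\in S}x^k$, $p$ the smallest root of $f$ and $r$ the magnitude of the second smallest root. Let $E_n$ denote expectation with respect to the uniform probability measure on the set of $S$-restricted compositions of $n$, and let $\mathbf{B}(\vec\lambda)=\prod_i\lambda_i$ be the product of the parts. There exist constants $a_1>0$ and $a_0$ such that, for any $q\in(p,\min(1,r))$, $$E_n(\log\mathbf{B})=a_1n+a_0+O\!\left(n\left(\tfrac{p}{q}\right)^n\right).$$ Specifically, $$a_1=\frac{\sum(\log k)p^k}{\sum kp^k},\qquad a_0=\frac{\sum(\log k)p^k\,\sum k^2p^k}{\left(\sum kp^k\right)^2}-\frac{\sum k(\log k)p^k}{\sum kp^k},$$ where all sums are over $k\in S$.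
   Context: ''Proper cofinite'' means $\mathbb{Z}_+\setminus S$ is finite and nonempty. An $S$-restricted composition of $n$ is a finite sequence $(\lambda_1,\dots,\lambda_\ell)$ of elements of $S$ summing to $n$. The function $f$ extends to a rational function on $\mathbb{C}$ (using $\sum_{k\ge1}x^k=x/(1-x)$) whose roots are the zeros of the polynomial $(1-x)f(x)$. The root of smallest magnitude is a real number $p\in(\tfrac12,1)$ of multiplicity one and all other roots have magnitude strictly greater than $p$; $r$ denotes the minimum of $|z|$ over roots $z\ne p$ of $f$. *)

(* Defs.v *)
From HB Require Import structures.
From mathcomp Require Export all_boot all_order all_algebra finmap.
From mathcomp Require Export complex.
From mathcomp Require Export all_classical all_reals all_analysis.
Export Order.TTheory GRing.Theory Num.Theory numFieldNormedType.Exports.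

Set Implicit Arguments.
Unset Strict Implicit.
Unset Printing Implicit Defensive.

Local Open Scope classical_set_scope.
Local Open Scope complex_scope.
Local Open Scope ring_scope.

Definition positive_integers : set nat := [set k | (0 < k)%N].

Definition gaps (S : set nat) : set nat := positive_integers `\` S.

Definition proper_cofinite (S : set nat) : Prop :=
  [/\ S `<=` positive_integers, finite_set (gaps S) & gaps S !=set0].

Definition compositions (S : set nat) (n : nat) : set (seq nat) :=
  [set l : seq nat | (forall k, k \in l -> S k) /\ sumn l = n].

Definition part_product (l : seq nat) : nat := (\prod_(k <- l) k)%N.

(* Expectation of X under the uniform probability measure on the finite set A.
   It is 0 when A is empty, which for compositions of n happens for finitely
   many n only. *)
Definition uniform_expectation (R : realType) (T : choiceType) (A : set T)
    (X : T -> R) : R :=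
  (\sum_(t \in A) X t) / (#|` fset_set A|)%:R.

Definition series_over (R : realType) (S : set nat) (u : nat -> R) : R :=
  \big[+%R/0]_(0 <= k <oo | k \in S) u k.

(* The rational extension of f(z) = 1 - \sum_(k in S) z^k, obtained from
   \sum_(k >= 1) z^k = z / (1 - z) by removing the finitely many gaps of S. *)
Definition f_ext (R : realType) (S : set nat) (z : R[i]) : R[i] :=
  1 - (z / (1 - z) - \sum_(t \in gaps S) z ^+ t).

(* The polynomial (1 - x) f(x). *)
Definition f_num (R : realType) (S : set nat) : {poly R[i]} :=
  (1 - 'X) - ('X - (1 - 'X) * \sum_(t \in gaps S) ('X^t : {poly R[i]})).

Definition f_root (R : realType) (S : set nat) (z : R[i]) : Prop :=
  root (f_num R S) z.

Definition smallest_root (R : realType) (S : set nat) (p : R) : Prop :=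
  f_root S p%:C /\ forall z : R[i], f_root S z -> `|p%:C| <= `|z|.

Definition second_root_magnitude (R : realType) (S : set nat) (p r : R) : Prop :=
  (exists z : R[i], [/\ f_root S z, z != p%:C & `|z| = r%:C]) /\
  forall z : R[i], f_root S z -> z != p%:C -> r%:C <= `|z|.

Lemma f_numE (R : realType) (S : set nat) (z : R[i]) :
  finite_set (gaps S) -> z != 1 -> (f_num R S).[z] = (1 - z) * f_ext S z.
Proof.
move=> finS z1; rewrite /f_num /f_ext !fsbig_finite//=.
rewrite !hornerE horner_sum (eq_bigr (fun t => z ^+ t)) => [|t _]; last by rewrite hornerXn.
have z1' : 1 - z != 0 by rewrite subr_eq0 eq_sym.
by rewrite !mulrBr mulr1 [(1 - z) * (z / _)]mulrC divfK.
Qed.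

Lemma f_rootE (R : realType) (S : set nat) (z : R[i]) :
  finite_set (gaps S) -> f_root S z <-> z != 1 /\ f_ext S z = 0.
Proof.
move=> finS; rewrite /f_root /root; split=> [fz|[z1 fz]]; last first.
  by rewrite f_numE// fz mulr0.
have z1 : z != 1.
  apply: contraTneq fz => ->.
  by rewrite /f_num !hornerE subrr mul0r !subr0 sub0r oppr_eq0 oner_eq0.
split=> //; move: fz; rewrite f_numE// mulf_eq0 subr_eq0 eq_sym (negbTE z1)/=.
by move/eqP.
Qed.

Lemma cvg_expC (R : realType) (z : R[i]) :
  `|z| < 1 -> (fun n => z ^+ n : R[i]^o) @ \oo --> (0 : R[i]^o).
Proof.
move=> z1; apply/cvgr0Pnorm_lt => e e0.
pose x : R := complex.Re `|z|; pose d : R := complex.Re (e : R[i]).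
have eE : e = d%:C by rewrite RRe_real// gtr0_real.
have zE : `|z| = x%:C by rewrite RRe_real// normr_real.
have d0 : 0 < d by rewrite -ltcR -eE.
have x0 : 0 <= x by rewrite -lecR -zE; exact: normr_ge0.
have x1 : x < 1 by rewrite -ltcR -zE.
have /cvgr0Pnorm_lt/(_ _ d0) : (fun n => x ^+ n) @ \oo --> (0 : R).
  by apply: cvg_expr; rewrite ger0_norm.
apply: filterS => n.
rewrite ger0_norm ?exprn_ge0// eE => xd.
by rewrite [ltLHS](normrX n z) zE -rmorphXn ltcR.
Qed.

Lemma f_ext_series (R : realType) (S : set nat) (z : R[i]) :
  proper_cofinite S -> `|z| < 1 ->
  (fun n => 1 - \sum_(0 <= k < n | k \in S) z ^+ k : R[i]^o) @ \oo
    --> (f_ext S z : R[i]^o).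
Proof.
move=> [Spos finS _] z1.
have z1' : 1 - z != 0.
  by apply: contraTneq z1 => /eqP; rewrite subr_eq0 => /eqP <-; rewrite normr1 ltxx.
rewrite /f_ext fsbig_finite//=.
set F := fset_set _.
have FP k : (k \in F) = (k \in gaps S) by rewrite in_fset_set.
have [N FN] : exists N, forall k, k \in F -> (k < N)%N.
  exists (\max_(k <- F) k).+1 => k kF.
  by rewrite ltnS; exact: (@leq_bigmax_seq _ _ xpredT id).
have main n : (N <= n)%N -> (0 < n)%N ->
    1 - \sum_(0 <= k < n | k \in S) z ^+ k =
    1 - ((1 - z ^+ n) / (1 - z) - 1 - \sum_(t <- F) z ^+ t).
  move=> Nn n0; congr (1 - _).
  have -> : \sum_(t <- F) z ^+ t = \sum_(0 <= t < n | t \in F) z ^+ t.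
    rewrite -[RHS]big_filter; apply: perm_big; apply: uniq_perm.
    - exact: fset_uniq.
    - by rewrite filter_uniq// iota_uniq.
    - move=> k; rewrite mem_filter mem_index_iota /=.
      by case: (boolP (k \in F)) => //= /FN kN; rewrite (leq_trans kN Nn).
  have -> : (1 - z ^+ n) / (1 - z) = \sum_(0 <= k < n) z ^+ k.
    rewrite -[1 - z ^+ n]opprB subrX1 -mulNr opprB mulrC mulKf// big_mkord.
    by [].
  rewrite [in RHS](bigID (mem S))/=.
  suff -> : \sum_(0 <= k < n | k \notin S) z ^+ k
      = 1 + \sum_(0 <= t < n | t \in F) z ^+ t :> R[i].
    by rewrite [1 + _]addrC !addrA !addrK.
  rewrite [LHS]big_mkcond [X in _ = _ + X]big_mkcond/=.
  rewrite [LHS]big_ltn// [X in _ = _ + X]big_ltn//.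
  have -> : (0%N \in S) = false by apply/negbTE/negP => /set_mem /Spos.
  have -> : (0%N \in F) = false by rewrite FP; apply/negbTE/negP => /set_mem [].
  rewrite expr0 add0r; congr (1 + _); apply: eq_big_nat => k /andP[k0 _].
  rewrite FP /gaps in_setD.
  have -> : k \in positive_integers by apply/mem_set.
  by [].
apply: (@cvg_trans _ ((fun n => 1 - ((1 - z ^+ n) / (1 - z) - 1
    - \sum_(t <- F) z ^+ t)) @ \oo)).
  apply: near_eq_cvg; exists (maxn N 1) => // n /=.
  by rewrite geq_max => /andP[Nn n0]; rewrite main.
have -> : z / (1 - z) = (1 - 0) / (1 - z) - 1.
  by apply: (mulIf z1'); rewrite mulrBl !divfK// mul1r subr0 opprB addrC subrK.
have aux (K : numFieldType) (u : nat -> K) (c s : K) : u @ \oo --> (0 : K) ->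
    (fun n => 1 - ((1 - u n) * c - 1 - s)) @ \oo --> 1 - ((1 - 0) * c - 1 - s).
  move=> u0; apply: cvgB; first exact: cvg_cst.
  apply: cvgB; last exact: cvg_cst.
  apply: cvgB; last exact: cvg_cst.
  apply: cvgM; last exact: cvg_cst.
  by apply: cvgB => //; exact: cvg_cst.
exact: (aux R[i] (fun n => z ^+ n) _ _ (cvg_expC z1)).
Qed.

Lemma finite_compositions (S : set nat) (n : nat) :
  S `<=` positive_integers -> finite_set (compositions S n).
Proof.
move=> Spos.
pose g (t : {m : 'I_n.+1 & m.-tuple 'I_n.+1}) : seq nat :=
  map val (tagged t).
apply: (@sub_finite_set _ _ (range g)); last exact/finite_image/finite_finset.
move=> l [lS ln].
have le_part k : k \in l -> (k < n.+1)%N.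
  move=> kl; rewrite ltnS -ln; elim: l kl {lS ln} => //= a l IH.
  rewrite inE => /predU1P[->|/IH h]; first exact: leq_addr.
  exact: leq_trans h (leq_addl _ _).
have le_size : (size l < n.+1)%N.
  rewrite ltnS -ln; elim: l lS {le_part ln} => //= a l IH lS.
  have a0 : (0 < a)%N by apply/Spos/lS; rewrite mem_head.
  rewrite -add1n leq_add// IH// => k kl; apply: lS.
  by rewrite in_cons kl orbT.
pose s : seq 'I_n.+1 := map inord l.
have ss : size s == Ordinal le_size by rewrite size_map.
exists (Tagged (fun m : 'I_n.+1 => m.-tuple 'I_n.+1)
          (Tuple ss : (Ordinal le_size).-tuple 'I_n.+1)) => //.
rewrite /g /= /s -map_comp -[RHS]map_id; apply/eq_in_map => k /le_part kn.
by rewrite /= inordK.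
Qed.

(* Main.v *)
From HB Require Import structures.
Require Import Defs.
From mathcomp Require Import ring lra zify.

(** Rescale by [p]: put [sg_k = p^k] for [k] in [S] (a probability distribution),
    [lg_k = ln k * sg_k], and let [c_n], [b_n] be [p^n] times the number of
    compositions of [n] and the sum of [ln B] over them.  As formal power series
    [(1 - sg) c = 1] and [(1 - sg) b = lg c].  With [D = 1 - X] one has
    [1 - sg = D t], so that [h = D c] is the inverse of [t] and
    [D^2 b = lg h^2].  For [s = q / p > 1], call a series [u] summable when
    [sum |u_n| s^n] is finite; this is a subring, stable under division by
    [X - z] whenever [s < |z|].  Since [(1 - p X) t] is a polynomial whose complex
    roots all have modulus greater than [s], [t] and [h] are summable.  A summable [u]
    equals [u(1) - u'(1) D] modulo [D^2] times a summable series, and dividing the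
    resulting expansions of [h] and [lg h^2] by [D] and [D^2] gives
    [c_n = 1/m + O(s^-n)] and [b_n = alpha (n + 1) + beta + O(s^-n)]. *)

Local Open Scope classical_set_scope.
Local Open Scope ring_scope.

(** * Formal power series over a commutative ring *)

Definition fps (K : Type) : Type := nat -> K.

(** Only the additive structure comes from functions; the product put on [fps] below is convolution,
    not the pointwise one. *)
HB.instance Definition _ (K : comNzRingType) := GRing.Zmodule.copy (fps K) (nat -> K).

Section FormalPowerSeries.
Set Implicit Arguments.
Unset Strict Implicit.
Variable K : comNzRingType.
Implicit Types (u v w : fps K) (p : {poly K}).

Definition fps_mul u v : fps K := fun n => \sum_(i < n.+1) u i * v (n - i)%N.

Definition fps_of_poly p : fps K := fun n => p`_n.

Let trunc (n : nat) u : {poly K} := \poly_(i < n.+1) u i.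

Let coef_trunc n u i : (i <= n)%N -> (trunc n u)`_i = u i.
Proof. by move=> le_in; rewrite coef_poly ltnS le_in. Qed.

(** Coefficient [n] of a product involves only indices up to [n], so the ring laws can be borrowed
    from polynomials by truncating. *)
Let fps_mul_trunc N u v n : (n <= N)%N ->
  fps_mul u v n = (trunc N u * trunc N v)`_n.
Proof.
move=> nN; rewrite coefM; apply: eq_bigr => i _.
have iN : (i <= N)%N by rewrite (leq_trans _ nN)// -ltnS.
by rewrite !coef_trunc// (leq_trans (leq_subr _ _) nN).
Qed.

Lemma fps_mulC : commutative fps_mul.
Proof.
by move=> u v; apply/funext => n; rewrite !(fps_mul_trunc _ _ (leqnn n)) mulrC.
Qed.

Lemma fps_mulA : associative fps_mul.
Proof.
move=> u v w; apply/funext => n.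
have nN := leqnn n.
transitivity ((trunc n u * (trunc n v * trunc n w))`_n).
  rewrite coefM; apply: eq_bigr => i _.
  rewrite coef_trunc; last by rewrite -ltnS.
  by rewrite (fps_mul_trunc (N := n))// leq_subr.
rewrite mulrA coefM; apply: eq_bigr => i _.
rewrite coef_trunc ?leq_subr// (fps_mul_trunc (N := n))//.
by rewrite -ltnS.
Qed.

Lemma fps_of_polyM p q : fps_of_poly (p * q) = fps_mul (fps_of_poly p) (fps_of_poly q).
Proof. by apply/funext => n; rewrite /fps_of_poly coefM. Qed.

Lemma fps_mul1 : left_id (fps_of_poly 1) fps_mul.
Proof.
move=> u; apply/funext => n.
rewrite /fps_mul big_ord_recl /= subn0 /fps_of_poly coef1 mul1r.
by rewrite big1 ?addr0// => i _; rewrite coef1 mul0r.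
Qed.

Lemma fps_mulDl : left_distributive fps_mul +%R.
Proof.
move=> u v w; apply/funext => n; transitivity (fps_mul u w n + fps_mul v w n) => //.
rewrite /fps_mul -big_split /=.
by apply: eq_bigr => i _; rewrite -mulrDl.
Qed.

Lemma fps_1_neq0 : fps_of_poly 1 != 0.
Proof.
apply/eqP => /(congr1 (fun u : fps K => u 0%N)) /eqP.
by rewrite /fps_of_poly coef1 /= oner_eq0.
Qed.

HB.instance Definition _ := GRing.Zmodule_isComNzRing.Build (fps K)
  fps_mulA fps_mulC fps_mul1 fps_mulDl fps_1_neq0.

Lemma fps_of_poly_is_zmod_morphism : zmod_morphism fps_of_poly.
Proof. by move=> p q; apply/funext => n; rewrite /fps_of_poly coefB. Qed.

Lemma fps_of_poly_is_monoid_morphism : monoid_morphism fps_of_poly.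
Proof. by split=> // p q; rewrite fps_of_polyM. Qed.

HB.instance Definition _ := GRing.isZmodMorphism.Build {poly K} (fps K)
  fps_of_poly fps_of_poly_is_zmod_morphism.
HB.instance Definition _ := GRing.isMonoidMorphism.Build {poly K} (fps K)
  fps_of_poly fps_of_poly_is_monoid_morphism.

Lemma fpsD u v n : (u + v) n = u n + v n. Proof. by []. Qed.
Lemma fpsN u n : (- u) n = - u n. Proof. by []. Qed.
Lemma fpsB u v n : (u - v) n = u n - v n. Proof. by []. Qed.
Lemma fpsM u v n : (u * v) n = \sum_(i < n.+1) u i * v (n - i)%N. Proof. by []. Qed.
Lemma fps1 n : (1 : fps K) n = (n == 0%N)%:R. Proof. by rewrite -coef1. Qed.

Lemma fpsCM a u n : (fps_of_poly a%:P * u) n = a * u n.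
Proof.
rewrite fpsM big_ord_recl /= subn0 /fps_of_poly coefC /= big1 ?addr0// => i _.
by rewrite coefC mul0r.
Qed.

Lemma fpsXM u n : (fps_of_poly 'X * u) n = if n is n'.+1 then u n' else 0.
Proof.
rewrite fpsM /fps_of_poly big_ord_recl coefX mul0r add0r.
case: n => [|n]; first by rewrite big_ord0.
rewrite big_ord_recl coefX mul1r big1 ?addr0.
  by rewrite /= subSS subn0.
by move=> i _; rewrite coefX mul0r.
Qed.

Lemma fps_geometric a : (1 - fps_of_poly (a *: 'X)) * (fun n => a ^+ n : K) = 1 :> fps K.
Proof.
apply/funext => n; rewrite mulrBl mul1r -mul_polyC rmorphM -mulrA fpsB fpsCM fpsXM fps1.
by case: n => [|n]; rewrite ?mulr0 ?subr0// exprS subrr.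
Qed.

End FormalPowerSeries.

(** Bounded partial sums instead of a limit, so that the same notion serves over [R] and over
    [R[i]]. *)
Definition wsummable {K : numFieldType} (s : K) (u : fps K) : Prop :=
  exists M, forall N, \sum_(i < N) `|u i| * s ^+ i <= M.

(** * The ring of weighted summable series *)

Section WeightedSummability.
Set Implicit Arguments.
Unset Strict Implicit.
Variables (K : numFieldType) (s : K).
Hypothesis s0 : 0 < s.
Implicit Types (u v w : fps K).

Let wt_ge0 (x : K) n : 0 <= `|x| * s ^+ n.
Proof. by rewrite mulr_ge0// exprn_ge0// ltW. Qed.

Lemma wsummable_le u v : (forall n, `|u n| <= `|v n|) ->
  wsummable s v -> wsummable s u.
Proof.
move=> uv [M vM]; exists M => N; apply: le_trans (vM N); apply: ler_sum => i _.
by rewrite ler_wpM2r// exprn_ge0// ltW.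
Qed.

Lemma wsummableD u v : wsummable s u -> wsummable s v -> wsummable s (u + v).
Proof.
move=> [M uM] [M' vM]; exists (M + M') => N.
apply: le_trans (lerD (uM N) (vM N)); rewrite -big_split /=.
by apply: ler_sum => i _; rewrite -mulrDl ler_wpM2r ?ler_normD// exprn_ge0// ltW.
Qed.

Lemma wsummableN u : wsummable s u -> wsummable s (- u).
Proof. by apply: wsummable_le => n; rewrite fpsN normrN. Qed.

Lemma wsummableB u v : wsummable s u -> wsummable s v -> wsummable s (u - v).
Proof. by move=> su sv; apply: wsummableD => //; exact: wsummableN. Qed.

(** Both sides sum over the triangle i + j < N, by diagonals and by rows. *)
Lemma sum_conv (a b : nat -> K) N :
  \sum_(n < N) \sum_(i < n.+1) a i * b (n - i)%N =
  \sum_(i < N) a i * \sum_(j < N - i) b j.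
Proof.
elim: N => [|N IH]; first by rewrite !big_ord0.
rewrite big_ord_recr [RHS]/= IH [LHS]/=.
rewrite [in RHS](eq_bigr (fun i : 'I_N.+1 => a i * \sum_(j < N - i) b j + a i * b (N - i)%N)).
  by rewrite big_split /= [in RHS]big_ord_recr /= subnn big_ord0 mulr0 addr0.
by move=> i _; rewrite subSn -1?ltnS// big_ord_recr mulrDr.
Qed.

(** The weight is multiplicative, s^n = s^i s^(n-i), so the weighted Cauchy product is dominated by
    the product of the two bounds. *)
Lemma wsummableM u v : wsummable s u -> wsummable s v -> wsummable s (u * v).
Proof.
move=> [M uM] [M' vM]; exists (M * M') => N.
have M'0 : 0 <= M' by have := vM 0%N; rewrite big_ord0.
pose a n := `|u n| * s ^+ n; pose b n := `|v n| * s ^+ n.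
apply: (@le_trans _ _ (\sum_(n < N) \sum_(i < n.+1) a i * b (n - i)%N)).
  apply: ler_sum => n _; rewrite fpsM.
  apply: (@le_trans _ _ ((\sum_(i < n.+1) `|u i * v (n - i)%N|) * s ^+ n)).
    by rewrite ler_wpM2r ?ler_norm_sum// exprn_ge0// ltW.
  rewrite mulr_suml; apply: ler_sum => i _; rewrite /a /b normrM mulrACA -exprD.
  by rewrite subnKC// -ltnS.
rewrite sum_conv; apply: (@le_trans _ _ (\sum_(i < N) a i * M')).
  by apply: ler_sum => i _; rewrite ler_wpM2l// /a.
by rewrite -mulr_suml ler_wpM2r.
Qed.

Lemma wsummable_poly (p : {poly K}) : wsummable s (fps_of_poly p).
Proof.
exists (\sum_(i < size p) `|p`_i| * s ^+ i) => N.
have [pN|Np] := leqP (size p) N.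
  rewrite -!(big_mkord xpredT (fun i => `|p`_i| * s ^+ i)).
  rewrite (big_cat_nat (n := size p))//= [X in _ + X]big_nat_cond [X in _ + X]big1 ?addr0//.
  by move=> i /andP[/andP[pi _] _]; rewrite nth_default// normr0 mul0r.
rewrite -!(big_mkord xpredT (fun i => `|p`_i| * s ^+ i)).
rewrite [leRHS](big_cat_nat (leq0n N) (ltnW Np)) /= lerDl.
by apply: sumr_ge0.
Qed.

(** With w = (X - z) v one has |z| |v_i| <= |w_i| + |v_(i-1)|. Weighting by s^i and summing gives
    |z| A_(N+1) <= M + s A_N, and as A is nondecreasing, (|z| - s) A_N <= M. *)
Lemma wsummable_divX z v : s < `|z| ->
  wsummable s (fps_of_poly ('X - z%:P) * v) -> wsummable s v.
Proof.
move=> sz [M wM]; pose A N := \sum_(i < N) `|v i| * s ^+ i.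
have zs : 0 < `|z| - s by rewrite subr_gt0.
exists (M / (`|z| - s)) => N; rewrite -/(A N) ler_pdivlMr//.
have AS N' : A N' <= A N'.+1 by rewrite /A big_ord_recr lerDl.
suff h : `|z| * A N.+1 <= M + s * A N.
  have : `|z| * A N <= M + s * A N by apply: le_trans h; rewrite ler_wpM2l.
  by rewrite -lerBlDr -mulrBl mulrC.
pose xv := fps_of_poly 'X * v.
have -> : s * A N = \sum_(i < N.+1) `|xv i| * s ^+ i.
  rewrite big_ord_recl /xv fpsXM normr0 mul0r add0r mulr_sumr.
  by apply: eq_bigr => i _; rewrite fpsXM /= exprS mulrCA.
apply: le_trans (lerD (wM N.+1) (lexx _)).
rewrite mulr_sumr -big_split /=; apply: ler_sum => i _.
rewrite mulrA -mulrDl ler_wpM2r ?exprn_ge0 ?(ltW s0)// rmorphB /= mulrBl -/xv fpsB fpsCM.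
by rewrite -normrM -lerBlDr distrC lerB_dist.
Qed.

Lemma wsummable_geometric a : 0 <= a -> a * s < 1 ->
  wsummable s (fun n => a ^+ n).
Proof.
(* The case a = 0 is separate because the argument below divides by X - 1/a, which turns the
   geometric series into the constant -1/a. *)
rewrite le_eqVlt => /predU1P[<- _|a0 as1].
  exists 1 => -[|N]; first by rewrite big_ord0.
  rewrite big_ord_recl !expr0 normr1 mulr1 big1 ?addr0// => i _.
  by rewrite expr0n normr0 mul0r.
have a'0 : a^-1 > 0 by rewrite invr_gt0.
apply: (@wsummable_divX a^-1); first by rewrite gtr0_norm// -div1r ltr_pdivlMr// mulrC.
have -> : fps_of_poly ('X - (a^-1)%:P) * (fun n => a ^+ n : K) =
    fps_of_poly (- (a^-1)%:P).
  rewrite -[RHS]mulr1 -(fps_geometric a) mulrA -[1 in RHS](rmorph1 (@fps_of_poly K)).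
  rewrite -rmorphB -rmorphM /=; congr (fps_of_poly _ * _).
  by rewrite mulrBr mulr1 mulNr opprK -mul_polyC mulrA -polyCM mulVf ?gt_eqF// mul1r addrC.
exact: wsummable_poly.
Qed.

End WeightedSummability.

(** * Division by a polynomial whose roots are all large *)

Section ClosedFieldDivision.
Set Implicit Arguments.
Unset Strict Implicit.

(** Over a closed field [Q] splits: the leading coefficient is inverted, then the linear factors are
    removed one at a time by [wsummable_divX]. *)
Lemma wsummable_divpoly (K : numClosedFieldType) (s : K) (Q : {poly K}) (v : fps K) :
  0 < s -> Q != 0 -> (forall z, root Q z -> s < `|z|) ->
  wsummable s (fps_of_poly Q * v) -> wsummable s v.
Proof.
move=> s0 Q0; have [rs Qrs] := closed_field_poly_normal Q.
have lQ0 : lead_coef Q != 0 by rewrite lead_coef_eq0.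
rewrite Qrs => Qroot /(wsummableM s0 (wsummable_poly s0 (lead_coef Q)^-1%:P)).
rewrite mulrA -rmorphM /= -mul_polyC mulrA -polyCM mulVf// polyC1 mul1r.
have {Qroot} : forall z, z \in rs -> s < `|z|.
  by move=> z zrs; apply: Qroot; rewrite rootZ// root_prod_XsubC.
elim: rs {Qrs} => [_|z rs IH zs]; first by rewrite big_nil rmorph1 mul1r.
rewrite big_cons rmorphM /= -mulrA => /wsummable_divX H.
apply: IH; first by move=> y yrs; apply: zs; rewrite in_cons yrs orbT.
by apply: H => //; apply: zs; rewrite mem_head.
Qed.

Local Open Scope complex_scope.

(** The embedding into [R[i]] preserves moduli, hence the weighted sums, and there [Q] splits. *)
Lemma wsummable_divpoly_real (R : realType) (s : R) (Q : {poly R}) (v : fps R) :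
  0 < s -> Q != 0 ->
  (forall z : R[i], root (map_poly (real_complex R) Q) z -> s%:C < `|z|) ->
  wsummable s (fps_of_poly Q * v) -> wsummable s v.
Proof.
move=> s0 Q0 Qroot [M wM].
have toC (u : fps R) N : \sum_(i < N) `|(u i)%:C| * s%:C ^+ i =
    (\sum_(i < N) `|u i| * s ^+ i)%:C.
  rewrite rmorph_sum; apply: eq_bigr => i _.
  by rewrite rmorphM rmorphXn /= normc_def /= expr0n /= addr0 sqrtr_sqr.
have [] : wsummable s%:C (fun n => (v n)%:C).
  apply: wsummable_divpoly Qroot _; rewrite ?ltcR// ?map_poly_eq0//.
  exists M%:C => N; rewrite (eq_bigr (fun i : 'I_N => `|((fps_of_poly Q * v) i)%:C| * s%:C ^+ i)).
    by rewrite toC lecR.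
  move=> i _; congr (`|_| * _); rewrite !fpsM rmorph_sum; apply: eq_bigr => j _.
  by rewrite /fps_of_poly coef_map /= rmorphM.
move=> M' vM'; exists (complex.Re M') => N.
(* The order on [R[i]] compares real parts, so the real part of the complex bound is a real
   bound. *)
have := vM' N; rewrite toC lecE => /andP[_]; exact.
Qed.

End ClosedFieldDivision.

(** The value u^(k)(1) / k!, that is, the coefficient of (X - 1)^k in the expansion of [u] at 1. *)
Definition binsum {R : realType} (k : nat) (u : fps R) : R :=
  limn (series (fun n => 'C(n, k)%:R * u n)).

(** * Binomial moments and division by 1 - X *)

Section Tails.
Set Implicit Arguments.
Unset Strict Implicit.
Variables (R : realType) (s : R).
Hypothesis s1 : 1 < s.
Implicit Types (u v w : fps R).

Let s0 : 0 < s. Proof. exact: lt_trans s1. Qed.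

Lemma wsummable_bound u : wsummable s u ->
  exists2 M, 0 <= M & forall n, `|u n| <= M * s^-1 ^+ n.
Proof.
move=> [M uM]; exists M; first by have := uM 0%N; rewrite big_ord0.
move=> n; rewrite exprVn ler_pdivlMr ?exprn_gt0//.
apply: le_trans (uM n.+1); rewrite big_ord_recr /= lerDr.
by apply: sumr_ge0 => i _; rewrite mulr_ge0// exprn_ge0// ltW.
Qed.

Lemma wsummable_cvg_series u w B : wsummable s u ->
  (forall n, `|w n| <= B * (`|u n| * s ^+ n)) -> cvgn (series w).
Proof.
move=> [M uM] wu; apply: normed_cvg.
apply: nondecreasing_is_cvgn.
  by apply: nondecreasing_series => n _ _ /=.
exists (`|B| * M) => _ [N _ <-]; rewrite /normed_series_of seriesEord /=.
apply: (@le_trans _ _ (`|B| * \sum_(i < N) `|u i| * s ^+ i)); last by rewrite ler_wpM2l.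
rewrite mulr_sumr; apply: ler_sum => i _; apply: le_trans (wu i) _.
by rewrite ler_wpM2r ?ler_norm// mulr_ge0// exprn_ge0// ltW.
Qed.

(** Keep the single term of index [k] in the binomial expansion of (1 + (s - 1))^n. *)
Lemma bin_le_expn k n : 'C(n, k)%:R <= (s - 1) ^- k * s ^+ n.
Proof.
have d0 : 0 < s - 1 by rewrite subr_gt0.
rewrite mulrC ler_pdivlMr ?exprn_gt0//.
have [nk|kn] := ltnP n k; first by rewrite bin_small// mul0r exprn_ge0// ltW.
have sE : s = 1 + (s - 1) by ring.
rewrite [in leRHS]sE [leRHS]exprDn.
have kn' : (k < n.+1)%N by [].
rewrite (bigD1 (Ordinal kn'))//= expr1n mul1r mulr_natl lerDl.
by apply: sumr_ge0 => i _; rewrite expr1n mul1r mulrn_wge0// exprn_ge0// ltW.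
Qed.

Lemma cvg_binsum k u : wsummable s u ->
  series (fun n => 'C(n, k)%:R * u n) @ \oo --> binsum k u.
Proof.
move=> su; apply: (wsummable_cvg_series (B := (s - 1) ^- k) su) => n.
by rewrite normrM normr_nat mulrCA [leLHS]mulrC ler_wpM2l// bin_le_expn.
Qed.

Lemma cvg_binsum0 u : wsummable s u -> series u @ \oo --> binsum 0 u.
Proof.
move=> /(@cvg_binsum 0); rewrite (_ : (fun n => _) = u)//.
by apply/funext => n; rewrite bin0 mul1r.
Qed.

(** Dividing by 1 - X takes partial sums. *)
Lemma series_fps_diff u v a N :
  (1 - fps_of_poly 'X) * v = fps_of_poly a%:P - u -> v N = a - series u N.+1.
Proof.
move=> Dv.
have Dvn n : v n - (if n is n'.+1 then v n' else 0) = (if n is 0%N then a else 0) - u n.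
  have := congr1 (fun x : fps R => x n) Dv; rewrite /= mulrBl mul1r !fpsB fpsXM => ->.
  by rewrite /fps_of_poly coefC; case: n.
elim: N => [|N IH].
  by rewrite /series /= big_nat1 -(Dvn 0%N) subr0.
have := Dvn N.+1; rewrite IH (seriesSr u N.+1) => /eqP; rewrite subr_eq => /eqP ->.
ring.
Qed.

(** Evaluation at X = 1: [v] tends to 0, while its terms are [a] minus the partial sums of [u]. *)
Lemma binsum_diff0 u v a : wsummable s u -> wsummable s v ->
  (1 - fps_of_poly 'X) * v = fps_of_poly a%:P - u -> a = binsum 0 u.
Proof.
move=> su sv Dv.
have v0 : v @ \oo --> (0 : R).
  by apply: cvg_series_cvg_0; apply/cvg_ex; exists (binsum 0 v); exact: cvg_binsum0.
have : (fun n => a - series u n.+1) @ \oo --> a - binsum 0 u.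
  apply: cvgB; first exact: cvg_cst.
  by rewrite (cvg_shiftS (series u)); exact: cvg_binsum0.
rewrite (_ : (fun n => _) = v) => [H|]; last by apply/funext => n; rewrite (series_fps_diff n Dv).
by apply/eqP; rewrite -subr_eq0; apply/eqP; apply: cvg_unique H v0.
Qed.

(** Since (X - 1) v = u - a, the coefficients of [v] at 1 are those of [u] shifted by one. *)
Lemma binsum_diff k u v a : wsummable s u -> wsummable s v ->
  (1 - fps_of_poly 'X) * v = fps_of_poly a%:P - u ->
  binsum k v = binsum k.+1 u.
Proof.
move=> su sv Dv.
(* Summation by parts, using Pascal's rule and u_(N+1) = v_N - v_(N+1). *)
have parts N : series (fun n => 'C(n, k)%:R * v n) N =
    'C(N, k.+1)%:R * v N + series (fun n => 'C(n, k.+1)%:R * u n) N.+1.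
  elim: N => [|N IH].
    by rewrite /series /= big_nil big_nat1 bin0n !mul0r addr0.
  rewrite seriesSr IH [in RHS]seriesSr binS natrD.
  have -> : u N.+1 = v N - v N.+1.
    by rewrite !(series_fps_diff _ Dv) (seriesSr u N.+1); ring.
  ring.
have := @cvg_binsum k v sv; rewrite (funext parts).
(* The boundary term vanishes because it is the general term of a convergent series. *)
have Cv0 : (fun N => 'C(N, k.+1)%:R * v N) @ \oo --> (0 : R).
  by apply: cvg_series_cvg_0; apply/cvg_ex; exists (binsum k.+1 v); exact: cvg_binsum.
have Su : (fun N => series (fun n => 'C(n, k.+1)%:R * u n) N.+1) @ \oo --> binsum k.+1 u.
  by rewrite (cvg_shiftS (series _)); exact: cvg_binsum.
move=> /(cvg_lim (@Rhausdorff R)) <-; apply: (cvg_lim (@Rhausdorff R)).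
by rewrite -[binsum _ _]add0r; exact: cvgD Cv0 Su.
Qed.

Lemma sum_expn_lt N J : (\sum_(n < N | (n < J)%N) s ^+ n) * (s - 1) <= s ^+ J.
Proof.
suff -> : (\sum_(n < N | (n < J)%N) s ^+ n) * (s - 1) = s ^+ (minn N J) - 1.
  by rewrite lerBlDr (le_trans (ler_weXn2l (ltW s1) (geq_minr N J)))// lerDl.
elim: N => [|N IH]; first by rewrite big_ord0 min0n mul0r expr0 subrr.
rewrite big_mkcond big_ord_recr -big_mkcond /= mulrDl IH.
case: ltnP => NJ.
  by rewrite (minn_idPl NJ) exprS; ring.
by rewrite (minn_idPr (leqW NJ)) mul0r addr0.
Qed.

(** The quotient has the tails of [u] as coefficients. Exchanging sums, |u_j| is counted with the
    weights s^n for n < j, whose total is at most s^j / (s - 1). *)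
Lemma wsummable_tail u : wsummable s u -> exists2 v, wsummable s v &
  (1 - fps_of_poly 'X) * v = fps_of_poly (binsum 0 u)%:P - u.
Proof.
move=> su; pose v : fps R := fun n => binsum 0 u - series u n.+1.
have d0 : 0 < s - 1 by rewrite subr_gt0.
exists v; last first.
  apply/funext => n; rewrite mulrBl mul1r !fpsB fpsXM /fps_of_poly coefC /v.
  case: n => [|n] /=; first by rewrite subr0 seriesSr /series /= big_nil add0r.
  by rewrite (seriesSr u n.+1); ring.
have [M uM] := su; exists (M / (s - 1)) => N.
(* Tails are cut at [J], which keeps the double sum finite; the bound is uniform in [J], and [J]
   then tends to infinity. *)
pose F J := \sum_(n < N) `|\sum_(n.+1 <= j < J) u j| * s ^+ n.
have FS J : F J.+1 <= F J + `|u J| * s ^+ J / (s - 1).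
  apply: (@le_trans _ _ (F J + `|u J| * \sum_(n < N | (n < J)%N) s ^+ n)); last first.
    by rewrite lerD2l -mulrA ler_wpM2l// ler_pdivlMr// sum_expn_lt.
  rewrite mulr_sumr [X in _ + X]big_mkcond -big_split /=; apply: ler_sum => n _.
  case: ltnP => nJ.
    rewrite big_nat_recr//= -mulrDl ler_wpM2r ?ler_normD// exprn_ge0// ltW//.
  by rewrite addr0 !big_geq// ltnW.
have FM J : F J <= M / (s - 1).
  apply: (@le_trans _ _ ((\sum_(j < J) `|u j| * s ^+ j) / (s - 1))); last first.
    by rewrite ler_wpM2r// invr_ge0 ltW.
  elim: J => [|J IH].
    by rewrite /F big1 ?big_ord0 ?mul0r// => n _; rewrite big_geq// normr0 mul0r.
  by rewrite big_ord_recr /= mulrDl; apply: le_trans (FS J) _; rewrite lerD2r.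
have Fcvg : F @ \oo --> \sum_(i < N) `|v i| * s ^+ i.
  apply: cvg_big; first exact: add_continuous.
  move=> i _; apply: cvgMl; apply: cvg_norm.
  apply: (@cvg_trans _ ((fun J => series u J - series u i.+1) @ \oo)).
    apply: near_eq_cvg; exists i.+1 => // J /= iJ.
    by rewrite sub_series iJ.
  by apply: cvgB; [exact: cvg_binsum0|exact: cvg_cst].
by apply: (cvgr_to_le Fcvg); exact: nearW.
Qed.

End Tails.

(** * Expansion of the renewal equations at 1 *)

Section RenewalExpansion.
Set Implicit Arguments.
Unset Strict Implicit.

(* Second-order expansion in powers of [D] of [l h^2], where [h] is the inverse
   of [t]; [im] stands for the inverse of the constant term [m] of [t]. *)
Lemma expand_quotient (A : comNzRingType) (D m im m2 L L' t h v1 v2 l l1 l2 : A) :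
    im * m = 1 -> t * h = 1 -> D * v1 = m - t -> D * v2 = m2 - v1 ->
    D * l1 = L - l -> D * l2 = L' - l1 ->
  let e := im * v1 * h in
  let e' := im * m2 * e - im * v2 * h in
  let k := (im ^+ 2 * m2) ^+ 2 + im * e' *+ 2 + im ^+ 2 * m2 * D * e' *+ 2 +
           D ^+ 2 * e' ^+ 2 in
  let w := L * k - L' * (im ^+ 3 * m2 *+ 2) - L' * D * k + l2 * h ^+ 2 in
  h = im + D * e /\
  l * h ^+ 2 = L * im ^+ 2 + (L * im ^+ 3 * m2 *+ 2 - L' * im ^+ 2) * D +
               D ^+ 2 * w.
Proof.
move=> imm th Dv1 Dv2 Dl1 Dl2 e e' k w.
have hE : h = im + D * e.
  have -> : D * e = im * m * h - im * (t * h).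
    transitivity (im * (D * v1) * h); first by rewrite /e; ring.
    by rewrite Dv1; ring.
  by rewrite imm th; ring.
have v1E : v1 = m2 - D * v2 by rewrite Dv2; ring.
have eE : e = im ^+ 2 * m2 + D * e'.
  have -> : e = im * m2 * h - D * (im * v2 * h) by rewrite {1}/e v1E; ring.
  by rewrite {1}hE /e'; ring.
have h2E : h ^+ 2 = im ^+ 2 + im ^+ 3 * m2 *+ 2 * D + D ^+ 2 * k.
  by rewrite hE eE /k; ring.
have lE : l = L - L' * D + D ^+ 2 * l2.
  have -> : l = L - D * l1 by rewrite Dl1; ring.
  have -> : l1 = L' - D * l2 by rewrite Dl2; ring.
  ring.
split=> //.
transitivity (L * h ^+ 2 - L' * D * h ^+ 2 + D ^+ 2 * (l2 * h ^+ 2)).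
  by rewrite {1}lE; ring.
rewrite /w; set l2h := l2 * h ^+ 2; rewrite h2E; ring.
Qed.

Variables (R : realType) (s : R).
Hypothesis s1 : 1 < s.
Let s0 : 0 < s. Proof. exact: lt_trans s1. Qed.

Let D : fps R := 1 - fps_of_poly 'X.
Let g : fps R := fun=> 1.

Let Dg : D * g = 1.
Proof.
rewrite -(fps_geometric 1) scale1r; congr (_ * _).
by apply/funext => n; rewrite expr1n.
Qed.

Local Ltac wsum := repeat first [assumption | exact: wsummable_poly | apply: wsummableM
  | apply: wsummableN | apply: wsummableD].

(** As D t = 1 - sg, the value and derivative of [t] at 1 are moments of [sg] one order higher.
    Dividing by [D] turns a constant into a constant sequence, and dividing by its square turns it
    into a multiple of n + 1. *)
Lemma renewal_expansion (sg t l c b : fps R) :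
    wsummable s sg -> wsummable s t -> wsummable s l -> wsummable s (D * c) ->
    D * t = 1 - sg -> (1 - sg) * c = 1 -> (1 - sg) * b = l * c ->
    binsum 1 sg != 0 ->
  exists w w' : fps R, [/\ wsummable s w, wsummable s w',
    forall n, c n = (binsum 1 sg)^-1 + w' n &
    forall n, b n = binsum 0 l / binsum 1 sg ^+ 2 * n.+1%:R +
      (binsum 0 l * binsum 2 sg *+ 2 / binsum 1 sg ^+ 3 -
       binsum 1 l / binsum 1 sg ^+ 2) + w n].
Proof.
move=> ssg st sl sh Dt cE bE m0; have [h hDc] : exists h, h = D * c by exists (D * c).
rewrite -hDc in sh; pose cst (a : R) : fps R := fps_of_poly a%:P.
have scst a : wsummable s (cst a) by exact: wsummable_poly.
have sD : wsummable s D.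
  by apply: wsummableB => //; rewrite -1?(rmorph1 (@fps_of_poly R)); exact: wsummable_poly.
have cstM x y : cst (x * y) = cst x * cst y by rewrite /cst polyCM rmorphM.
have cstX x n : cst (x ^+ n) = cst x ^+ n by rewrite /cst polyC_exp rmorphXn.
have cstB x y : cst (x - y) = cst x - cst y by rewrite /cst polyCB rmorphB.
have cstMn x n : cst (x *+ n) = cst x *+ n by rewrite /cst polyCMn rmorphMn.
have Dt' : D * t = cst 1 - sg by rewrite Dt /cst polyC1 rmorph1.
have th : t * h = 1 by rewrite hDc mulrA [t * D]mulrC Dt.
have [v1 sv1 Dv1] := wsummable_tail s1 st.
have [v2 sv2 Dv2] := wsummable_tail s1 sv1.
have [l1 sl1 Dl1] := wsummable_tail s1 sl.
have [l2 sl2 Dl2] := wsummable_tail s1 sl1.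
move: Dv1 Dv2 Dl1 Dl2; rewrite -/D => Dv1 Dv2 Dl1 Dl2.
(* The constants left by the tails are rewritten as moments: t(1) = [binsum 1 sg], v1(1) =
   [binsum 2 sg], l1(1) = [binsum 1 l]. *)
move: (Dl2) (Dv2) (Dv1).
rewrite (binsum_diff s1 _ sl sl1 Dl1) (binsum_diff s1 _ st sv1 Dv1).
rewrite !(binsum_diff s1 _ ssg st Dt') => {}Dl2 {}Dv2 {}Dv1.
set m := binsum 1 sg in m0 Dv1 *; set m2 := binsum 2 sg in Dv2 *.
set L := binsum 0 l in Dl1 *; set L' := binsum 1 l in Dl2 *.
have imm : cst m^-1 * cst m = 1 by rewrite -rmorphM -polyCM mulVf// polyC1 rmorph1.
have [] := expand_quotient imm th Dv1 Dv2 Dl1 Dl2.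
set e := (cst m^-1 * v1 * h); set e' := (_ - cst m^-1 * v2 * h).
set k := (_ ^+ 2 + _ + _ + _); set w := (_ - _ - _ + _) => hE lhE.
have se : wsummable s e by rewrite /e; wsum.
have se' : wsummable s e' by rewrite /e'; wsum.
have sk : wsummable s k by rewrite /k !mulr2n !expr2; wsum.
have sw : wsummable s w by rewrite /w !mulr2n !exprS !expr0 !mulr1; wsum.
(* The square of 1/(1 - X) is the source of the factor n + 1. *)
have gg n : (g * g) n = n.+1%:R.
  by rewrite fpsM /g (eq_bigr (fun=> 1)) ?sumr_const ?card_ord// => i _; rewrite mulr1.
exists w, e; split=> // n.
  have -> : c = cst m^-1 * g + e.
    rewrite -[c]mul1r -Dg mulrAC -hDc hE mulrDl mulrAC Dg mul1r.
    by [].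
  by rewrite fpsD fpsCM /g mulr1.
have Db : D ^+ 2 * b = l * h ^+ 2.
  have H : D * b = l * c * h.
    by rewrite -bE -Dt -[LHS]mul1r -th; ring.
  by rewrite expr2 -mulrA H hDc; ring.
have -> : b = cst (L / m ^+ 2) * (g * g) +
    cst (L * m2 *+ 2 / m ^+ 3 - L' / m ^+ 2) * g + w.
  transitivity ((g * D) ^+ 2 * b); first by rewrite [g * D]mulrC Dg expr1n mul1r.
  rewrite exprMn -mulrA Db lhE.
  rewrite -!exprVn mulrnAl cstB cstMn (cstM L (m^-1 ^+ 2)) (cstM (L * m2)) (cstM L m2) (cstM L').
  rewrite !cstX.
  transitivity (cst L * cst m^-1 ^+ 2 * (g * g) +
    (cst L * cst m^-1 ^+ 3 * cst m2 *+ 2 - cst L' * cst m^-1 ^+ 2) * g * (D * g) +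
    w * (D * g) ^+ 2); first by ring.
  by rewrite Dg; ring.
by rewrite !fpsD !fpsCM gg /g mulr1.
Qed.

End RenewalExpansion.

(** * Generating functions of compositions *)

Section Compositions.
Set Implicit Arguments.
Unset Strict Implicit.
Variable S : set nat.
Hypothesis Spos : S `<=` positive_integers.

Lemma compositions0 : compositions S 0 = [set [::]].
Proof.
apply/seteqP; split=> [[|k l] [lS]|_ ->]//= /eqP.
rewrite addn_eq0 => /andP[/eqP k0 _].
by have /Spos := lS k (mem_head _ _); rewrite k0.
Qed.

(** A composition of a positive integer is nonempty, hence given by its first part k and a
    composition of n - k. *)
Lemma sum_compositions (V : nmodType) (X : seq nat -> V) (n : nat) : (0 < n)%N ->
  \sum_(l \in compositions S n) X l =
  \sum_(k < n.+1 | (k : nat) \in S) \sum_(l \in compositions S (n - k)) X ((k : nat) :: l).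
Proof.
move=> n0; rewrite fsbig_finite; last exact: finite_compositions.
pose ks := [seq k <- iota 0 n.+1 | k \in S].
pose cs k : seq (seq nat) := fset_set (compositions S (n - k)).
have memc m (l : seq nat) : (l \in fset_set (compositions S m)) = (l \in compositions S m).
  by rewrite in_fset_set//; exact: finite_compositions.
rewrite (perm_big [seq k :: l | k <- ks, l <- cs k]) /=; last first.
  apply: uniq_perm; first exact: fset_uniq.
    apply: allpairs_uniq_dep => [|k _|[k l] [k' l'] _ _ /= [-> ->]//].
      by rewrite filter_uniq// iota_uniq.
    exact: fset_uniq.
  move=> l; rewrite memc; apply/idP/allpairsPdep.
    move=> /set_mem [lS ln]; case: l lS ln => [_ /= n0'|k l lS /= kln].
      by move: n0; rewrite -n0'.
    exists k, l; split=> //.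
      rewrite mem_filter mem_iota /= add0n ltnS -kln leq_addr andbT.
      by apply: mem_set; apply: lS; rewrite mem_head.
    rewrite /cs memc; apply: mem_set; split; last by rewrite -kln addKn.
    by move=> j jl; apply: lS; rewrite in_cons jl orbT.
  move=> [k [l' [kks]]]; rewrite /cs memc => /set_mem [lS ln] ->.
  move: kks; rewrite mem_filter mem_iota add0n ltnS /= => /andP[/set_mem kS kn].
  apply: mem_set; split; last by rewrite /= ln subnKC.
  by move=> j; rewrite in_cons => /predU1P[->//|/lS].
rewrite big_allpairs_dep big_filter -(big_mkord (fun k => k \in S)
  (fun k => \sum_(l \in compositions S (n - k)) X (k :: l))) /index_iota subn0.
apply: eq_bigr => k _; rewrite fsbig_finite//.
exact: finite_compositions.
Qed.

Lemma part_product_gt0 n l : compositions S n l -> (0 < part_product l)%N.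
Proof.
move=> [lS _]; rewrite /part_product big_seq; apply: prodn_cond_gt0 => k kl.
exact/Spos/lS.
Qed.

Variables (R : realType) (p : R).

Definition weight : fps R := fun k => if k \in S then p ^+ k else 0.

Definition log_weight : fps R := fun k => ln k%:R * weight k.

Definition count_gf : fps R :=
  fun n => (#|` fset_set (compositions S n)|)%:R * p ^+ n.

Definition log_product_gf : fps R :=
  fun n => (\sum_(l \in compositions S n) (ln (part_product l)%:R : R)) * p ^+ n.

Lemma cardE_compositions n :
  (#|` fset_set (compositions S n)|)%:R = \sum_(l \in compositions S n) (1 : R).
Proof.
rewrite fsbig_finite; last exact: finite_compositions.
by rewrite card_fset_sum1 natr_sum.
Qed.

Lemma weightM (u : fps R) (T : nat -> R) n : (forall i, u i = T i * p ^+ i) ->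
  (weight * u) n = (\sum_(k < n.+1 | (k : nat) \in S) T (n - k)%N) * p ^+ n.
Proof.
move=> uT; rewrite fpsM mulr_suml [RHS]big_mkcond; apply: eq_bigr => k _.
rewrite /weight uT; case: ifP => _; last by rewrite mul0r.
by rewrite mulrCA -exprD subnKC// -ltnS.
Qed.

(** The renewal equation from splitting off the first part; the constant term 1 counts the empty
    composition. *)
Lemma count_gfE : (1 - weight) * count_gf = 1.
Proof.
apply/funext => n; rewrite mulrBl mul1r fpsB fps1.
rewrite (weightM (T := fun n => (#|` fset_set (compositions S n)|)%:R))//.
rewrite /count_gf -mulrBl.
case: n => [|n] /=.
  rewrite expr0 mulr1 big_mkcond big_ord1.
  have -> : (0%N \in S) = false by apply/negbTE/negP => /set_mem /Spos.
  by rewrite compositions0 fset_set1 cardfs1 subr0.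
rewrite cardE_compositions sum_compositions//.
rewrite (eq_bigr _ (fun (k : 'I_n.+2) _ => esym (cardE_compositions (n.+1 - k)))).
by rewrite subrr mul0r.
Qed.

(** Splitting off a first part k adds ln k to the logarithm of the product, once for each
    composition of n - k. *)
Lemma log_product_gfE : (1 - weight) * log_product_gf = log_weight * count_gf.
Proof.
apply/funext => n; rewrite mulrBl mul1r fpsB.
pose T n := \sum_(l \in compositions S n) (ln (part_product l)%:R : R).
rewrite (weightM (T := T))//.
have -> : (log_weight * count_gf) n =
    (\sum_(k < n.+1 | (k : nat) \in S)
       ln (k : nat)%:R * (#|` fset_set (compositions S (n - k))|)%:R) * p ^+ n.
  rewrite fpsM mulr_suml [RHS]big_mkcond; apply: eq_bigr => k _.
  rewrite /log_weight /weight; case: ifP => _; last by rewrite mulr0 mul0r.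
  by rewrite /count_gf mulrACA -exprD subnKC// -ltnS.
rewrite {1}/log_product_gf -/(T n) -mulrBl; congr (_ * _); apply/eqP.
rewrite subr_eq -big_split /=; apply/eqP.
case: n => [|n].
  rewrite /T compositions0 fsbig_set1 /part_product big_nil ln1.
  rewrite big_mkcond big_ord1.
  by have -> : (0%N \in S) = false by apply/negbTE/negP => /set_mem /Spos.
rewrite {1}/T sum_compositions//; apply: eq_bigr => k kS.
rewrite cardE_compositions /T !fsbig_finite; try exact: finite_compositions.
rewrite mulr_sumr -big_split /= big_seq [RHS]big_seq; apply: eq_bigr => l.
rewrite in_fset_set; last exact: finite_compositions.
move=> /set_mem /part_product_gt0 l0; rewrite mulr1 /part_product big_cons natrM lnM//.
  by rewrite posrE ltr0n; apply: Spos; exact: set_mem.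
by rewrite posrE ltr0n.
Qed.

(** The factor p^n cancels; if there is no composition, both denominators are 0 and so are both
    quotients. *)
Lemma uniform_expectation_gf n : p != 0 ->
  uniform_expectation (compositions S n) (fun l => ln (part_product l)%:R : R) =
  log_product_gf n / count_gf n.
Proof.
move=> p0; rewrite /uniform_expectation /log_product_gf /count_gf.
by rewrite -mulf_div divff ?mulr1// expf_neq0.
Qed.

End Compositions.

(** For [G] the list of gaps this is (1 - x) f(x); the ring is left free so that it can be used over
    [R] and over [R[i]]. *)
Definition gap_poly {K : comNzRingType} (G : seq nat) : {poly K} :=
  (1 - 'X) * (1 + \sum_(t <- G) 'X^t) - 'X.

(** * The smallest root lies between 0 and 1 *)

Section RootLocation.
Set Implicit Arguments.
Unset Strict Implicit.
Local Open Scope complex_scope.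

Lemma horner_gap_poly (K : comNzRingType) G (x : K) :
  (gap_poly G).[x] = (1 - x) * (1 + \sum_(t <- G) x ^+ t) - x.
Proof.
rewrite /gap_poly !hornerE horner_sum; congr (_ * (_ + _) - _).
by apply: eq_bigr => t _; rewrite hornerXn.
Qed.

Lemma gap_poly_realC (R : realType) G (x : R) :
  (gap_poly G).[x%:C] = (gap_poly G).[x]%:C.
Proof.
rewrite !horner_gap_poly rmorphB rmorphM rmorphB rmorphD rmorph1 rmorph_sum.
by congr (_ * (_ + _) - _); apply: eq_bigr => t _; rewrite rmorphXn.
Qed.

(** Even powers cancel and odd ones double; the sum of 2 y^t over all odd t is 2 y / (1 - y^2),
    which a finite set of exponents cannot reach. This serves to exclude a negative smallest
    root. *)
Lemma odd_power_sum_lt (R : realType) (y : R) (G : seq nat) : 0 < y -> y < 1 -> uniq G ->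
  (1 - y ^+ 2) * (\sum_(t <- G) y ^+ t - \sum_(t <- G) (- y) ^+ t) < y *+ 2.
Proof.
move=> y0 y1 uG.
have y2 : 0 <= 1 - y ^+ 2 by rewrite subr_ge0 exprn_ile1// ltW.
pose a t := y ^+ t - (- y) ^+ t.
have a0 t : 0 <= a t.
  rewrite /a exprNn -signr_odd; case: (odd t); rewrite ?expr0 ?expr1 ?mul1r ?subrr//.
  by rewrite mulN1r opprK addr_ge0// exprn_ge0// ltW.
rewrite -sumrB -/a.
(* An even cutoff beyond all exponents lets the terms pair up into a closed geometric sum. *)
pose K := (\max_(t <- G) t).+1.
have GK t : t \in G -> (t < K.*2)%N.
  move=> tG; rewrite (@leq_trans K)//; last by rewrite -addnn leq_addr.
  by rewrite ltnS; exact: (@leq_bigmax_seq _ _ xpredT id).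
apply: (@le_lt_trans _ _ ((1 - y ^+ 2) * \sum_(0 <= t < K.*2) a t)).
  rewrite ler_wpM2l//.
  have -> : \sum_(t <- G) a t = \sum_(0 <= t < K.*2 | t \in G) a t.
    rewrite -[RHS]big_filter; apply: perm_big; apply: uniq_perm => //.
      by rewrite filter_uniq// iota_uniq.
    move=> t; rewrite mem_filter mem_index_iota /=.
    by case: (boolP (t \in G)) => //= /GK.
  by rewrite big_mkcond /=; apply: ler_sum => t _; case: ifP.
have -> : (1 - y ^+ 2) * \sum_(0 <= t < K.*2) a t = y *+ 2 * (1 - (y ^+ 2) ^+ K).
  elim: K {GK} => [|k IH]; first by rewrite big_geq// mulr0 expr0 subrr mulr0.
  rewrite doubleS !big_nat_recr//= !mulrDr IH /a -mul2n.
  rewrite (exprS y (2 * k)) (exprS (- y) (2 * k)) !exprM sqrrN (exprS (y ^+ 2)).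
  ring.
rewrite -[ltRHS]mulr1 ltr_pM2l ?mulrn_wgt0// ltrBlDr ltrDl.
by rewrite !exprn_gt0.
Qed.

Variables (R : realType) (S : set nat).
Hypothesis hS : proper_cofinite S.
Let G : seq nat := fset_set (gaps S).

Let GE t : (t \in G) = (t \in gaps S).
Proof. by have [_ finS _] := hS; rewrite in_fset_set. Qed.

Lemma gap0 : (0%N \in G) = false.
Proof. by rewrite GE; apply/negbTE/negP => /set_mem []. Qed.

Lemma f_num_gap_poly : f_num R S = gap_poly G.
Proof.
have [_ finS _] := hS; rewrite /f_num fsbig_finite// -/G /gap_poly.
by rewrite opprB addrA mulrDr mulr1 addrAC.
Qed.

Lemma f_root_real (x : R) : f_root S x%:C <-> (gap_poly G).[x] = 0.
Proof.
rewrite /f_root f_num_gap_poly /root gap_poly_realC.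
split=> [/eqP/complexI //|->]; by rewrite ?eqxx.
Qed.

Lemma normC_real (x : R) : `|x%:C| = `|x|%:C.
Proof. by rewrite normc_def /= expr0n /= addr0 sqrtr_sqr. Qed.

(** The polynomial is 1 at 0 and -1 at 1, so it has a root inside the interval and |p| < 1. The case
    p = 0 is immediate, and p = -y < 0 contradicts [odd_power_sum_lt]. *)
Lemma smallest_root_itv (p : R) : smallest_root S p -> 0 < p < 1.
Proof.
move=> [/f_root_real rp pmin].
have pminR x : (gap_poly G).[x] = 0 -> `|p| <= `|x|.
  by move=> /f_root_real /pmin; rewrite !normC_real lecR.
have P0 : (gap_poly G).[0 : R] = 1.
  rewrite horner_gap_poly !subr0 mul1r big_seq big1 ?addr0// => t tG.
  by rewrite expr0n; case: eqP tG => // ->; rewrite gap0.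
have ivt (b : R) : 0 <= b -> (gap_poly G).[b] <= 0 ->
    exists2 x, 0 <= x <= b & (gap_poly G).[x] = 0.
  move=> b0 Pb; have [||x xb] := @poly_ivt R (- gap_poly G) 0 b => //.
    by rewrite !hornerN P0 oppr_le0 ler01 oppr_ge0.
  by rewrite rootN => /rootP; exists x.
have p1 : `|p| < 1.
  have P1 : (gap_poly G).[1 : R] = -1.
    by rewrite horner_gap_poly subrr mul0r sub0r.
  have [||x /andP[x0 x1] Px] := ivt 1 => //; first by rewrite P1 oppr_le0.
  apply: le_lt_trans (pminR x Px) _; rewrite ger0_norm// lt_neqAle x1 andbT.
  by apply/eqP => xE; move: Px; rewrite xE P1 => /eqP; rewrite oppr_eq0 oner_eq0.
have [p0|p0|p0] := ltgtP 0 p; last first.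
- by move: rp; rewrite -p0 P0 => /eqP; rewrite oner_eq0.
- move: p1; rewrite ltr0_norm// => y1.
  set y := - p in y1; have y0 : 0 < y by rewrite oppr_gt0.
  (* A negative value at y would give a root in [0, y]; minimality of |p| = y forces that root to be
     y itself. *)
  have Py : 0 <= (gap_poly G).[y].
    rewrite leNgt; apply/negP => Py.
    have [||x /andP[x0 xy] Px] := ivt y; [exact: ltW|exact: ltW|].
    have := pminR x Px; rewrite ltr0_norm// ger0_norm// -/y => yx.
    have xE : x = y by apply/eqP; rewrite eq_le xy yx.
    by move: Py; rewrite -xE Px ltxx.
  have := odd_power_sum_lt y0 y1 (fset_uniq (fset_set (gaps S))); rewrite -/G.
  move: Py rp; rewrite !horner_gap_poly -[p]opprK -/y.
  set A := \sum_(t <- _) y ^+ t; set B := \sum_(t <- _) (- y) ^+ t.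
  move=> Py rp; suff : y *+ 2 <= (1 - y ^+ 2) * (A - B) by rewrite leNgt => /negbTE ->.
  have : 0 <= (1 + y) * ((1 - y) * (1 + A) - y).
    by rewrite mulr_ge0// addr_ge0// ltW.
  (* With P the gap polynomial, the right side is (1 + y) P(y) - (1 - y) P(-y) + 2 y, where P(-y) =
     0. *)
  have -> : (1 - y ^+ 2) * (A - B) =
     (1 + y) * ((1 - y) * (1 + A) - y) - (1 - y) * ((1 - - y) * (1 + B) - - y) + y *+ 2 by ring.
  by rewrite rp mulr0 subr0 => H; rewrite lerDr.
- by move: p1; rewrite gtr0_norm// => ->.
Qed.

End RootLocation.

(** * The weight series and its polynomial numerator *)

Section Weights.
Set Implicit Arguments.
Unset Strict Implicit.
Local Open Scope complex_scope.
Variables (R : realType) (S : set nat) (p : R).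
Hypothesis hS : proper_cofinite S.
Hypotheses (p0 : 0 < p) (p1 : p < 1).
Let G : seq nat := fset_set (gaps S).
Let geo : fps R := fun n => p ^+ n.
Let sg : fps R := weight S p.
Let lg : fps R := log_weight S p.
Let D : fps R := 1 - fps_of_poly 'X.

Let GE t : (t \in G) = (t \in gaps S).
Proof. by have [_ finS _] := hS; rewrite in_fset_set. Qed.

(** Supplies a term with ln k > 0, which makes the logarithmic mean strictly positive. *)
Lemma exists_ge2 : exists2 k, S k & (1 < k)%N.
Proof.
exists (\max_(t <- G) t).+2 => //; apply: contrapT => nS.
have : (\max_(t <- G) t).+2 \in G by rewrite GE; apply: mem_set.
by move=> /(@leq_bigmax_seq _ _ xpredT id _)/(_ isT); rewrite ltnNge leqW.
Qed.

Lemma weight_ge0 k : 0 <= sg k.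
Proof. by rewrite /sg /weight; case: ifP => // _; rewrite exprn_ge0// ltW. Qed.

Lemma log_weight_ge0 k : 0 <= lg k.
Proof.
rewrite /lg /log_weight; have [->|k0] := posnP k.
  by rewrite ln0// mul0r.
by rewrite mulr_ge0 ?weight_ge0// ln_ge0// ler1n.
Qed.

Lemma wsummable_weight s : 0 < s -> p * s < 1 -> wsummable s sg.
Proof.
move=> s0 ps; apply: (wsummable_le s0 _ (wsummable_geometric s0 (ltW p0) ps)) => k.
by rewrite /sg /weight; case: ifP => //; rewrite normr0.
Qed.

(** As ln k < k + 1, the terms are dominated by (k + 1) p^k, the coefficients of the squared
    geometric series. *)
Lemma wsummable_log_weight s : 0 < s -> p * s < 1 -> wsummable s lg.
Proof.
move=> s0 ps; have sgeo : wsummable s geo := wsummable_geometric s0 (ltW p0) ps.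
apply: (wsummable_le s0 _ (wsummableM s0 sgeo sgeo)) => k.
have -> : (geo * geo) k = k.+1%:R * p ^+ k.
  rewrite fpsM (eq_bigr (fun=> p ^+ k)).
    by rewrite sumr_const card_ord mulr_natl.
  by move=> i _; rewrite /geo -exprD subnKC// -ltnS.
rewrite !ger0_norm ?log_weight_ge0//; last by rewrite mulr_ge0// exprn_ge0// ltW.
rewrite /lg /log_weight /weight; case: ifP => [kS|_]; last first.
  by rewrite mulr0 mulr_ge0// exprn_ge0// ltW.
have [Spos _ _] := hS; have k0 : (0 < k)%N by apply: Spos; exact: set_mem.
rewrite ler_wpM2r ?exprn_ge0 ?(ltW p0)//.
by apply: (@le_trans _ _ k%:R); [rewrite ltW// ln_sublinear// ltr0n|rewrite ler_nat].
Qed.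

Lemma binsum_gt0 s k (u : fps R) n : 1 < s -> wsummable s u ->
  (forall i, 0 <= u i) -> (k <= n)%N -> 0 < u n -> 0 < binsum k u.
Proof.
move=> s1 su u0 kn un.
apply: (@lt_le_trans _ _ ('C(n, k)%:R * u n)).
  by rewrite mulr_gt0// ltr0n bin_gt0.
apply: (@le_trans _ _ (series (fun n => 'C(n, k)%:R * u n) n.+1)).
  rewrite seriesSr lerDr /series /=; apply: sumr_ge0 => i _.
  by rewrite mulr_ge0.
apply: nondecreasing_cvgn_le.
  by apply: nondecreasing_series => i _ _; rewrite mulr_ge0.
by apply/cvg_ex; exists (binsum k u); exact: (cvg_binsum s1).
Qed.

Lemma series_over_weight (X : nat -> R) :
  series_over S (fun k => X k * p ^+ k) = limn (series (fun k => X k * sg k)).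
Proof.
rewrite /series_over; congr (limn _); apply/funext => n.
rewrite /series /= big_mkcond; apply: eq_bigr => k _.
by rewrite /sg /weight; case: ifP => //; rewrite mulr0.
Qed.

(** The gap polynomial evaluated at p X: its root [p] moves to 1 and modulus [q] becomes q / p. *)
Let scaled_gap_poly : {poly R} :=
  (1 - p *: 'X) * (1 + \sum_(t <- G) (p *: 'X) ^+ t) - p *: 'X.

(** The weight series is the geometric series without its constant term and its gap terms, and 1 - p
    X clears the geometric series. *)
Lemma fps_scaled_gap_poly :
  (1 - fps_of_poly (p *: 'X)) * (1 - sg) = fps_of_poly scaled_gap_poly.
Proof.
pose gam : {poly R} := \sum_(t <- G) (p *: 'X) ^+ t.
have -> : sg = geo - 1 - fps_of_poly gam.
  apply/funext => n; rewrite !fpsB fps1 /geo.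
  have -> : fps_of_poly gam n = if n \in G then p ^+ n else 0.
    rewrite /fps_of_poly /gam coef_sum (eq_bigr (fun t => if t == n then p ^+ n else 0)).
      case: ifPn => nG.
        rewrite (bigD1_seq n)//= ?fset_uniq// eqxx big1 ?addr0//.
        by move=> i /negbTE ->.
      rewrite big_seq big1// => i iG; case: eqP => // iE.
      by move: nG; rewrite -iE iG.
    move=> t _; rewrite exprZn coefZ coefXn eq_sym.
    by case: eqP => [->|_]; rewrite ?mulr1 ?mulr0.
  have [Spos _ _] := hS; case: n => [|n].
    rewrite gap0// /sg /weight; have -> : (0%N \in S) = false.
      by apply/negbTE/negP => /set_mem /Spos.
    by rewrite expr0 !subrr.
  rewrite GE /gaps in_setD /sg /weight.
  have -> : n.+1 \in positive_integers by apply/mem_set.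
  by case: (n.+1 \in S); rewrite /= subr0 ?subrr ?subr0.
rewrite !rmorphB rmorphM rmorphB rmorphD rmorph1 /= -/gam.
have := fps_geometric p; rewrite -/geo.
set x := fps_of_poly (p *: 'X); set y := fps_of_poly gam => xg.
transitivity ((1 - x) * (1 + 1 + y) - (1 - x) * geo); first by ring.
by rewrite xg; ring.
Qed.

Lemma root_scaled_gap_poly (z : R[i]) :
  root (map_poly (real_complex R) scaled_gap_poly) z -> f_root S (p%:C * z).
Proof.
rewrite /f_root f_num_gap_poly// /root horner_gap_poly /scaled_gap_poly.
rewrite rmorphB rmorphM rmorphB rmorphD rmorph1 rmorph_sum /= map_polyZ map_polyX !hornerE.
rewrite horner_sum.
under [in X in X -> _]eq_bigr do
  rewrite rmorphXn /= map_polyZ map_polyX !hornerE.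
by [].
Qed.

(** The root 1 contributes the factor X - 1 = -D, and multiplying by the geometric series undoes 1 -
    p X. *)
Lemma weight_factorization : (@gap_poly R G).[p] = 0 ->
  exists2 Q : {poly R}, scaled_gap_poly = Q * ('X - 1) &
    D * - (geo * fps_of_poly Q) = 1 - sg.
Proof.
move=> Pp0; have /factor_theorem[Q QE] : root scaled_gap_poly 1.
  rewrite /root -[X in _ == X]Pp0 horner_gap_poly /scaled_gap_poly !hornerE.
  rewrite horner_sum; under eq_bigr do rewrite !hornerE.
  by [].
exists Q; first by rewrite QE polyC1.
transitivity ((1 - fps_of_poly (p *: 'X)) * geo * (1 - sg)); last first.
  by rewrite fps_geometric mul1r.
rewrite mulrAC fps_scaled_gap_poly QE polyC1.
by rewrite rmorphM rmorphB rmorph1 /= /D; ring.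
Qed.

End Weights.

(** * Moments, root separation and the error estimate *)

Section Asymptotics.
Set Implicit Arguments.
Unset Strict Implicit.
Local Open Scope complex_scope.
Variables (R : realType) (S : set nat) (p : R).
Hypothesis hS : proper_cofinite S.
Hypothesis hp : smallest_root S p.
Let sg : fps R := weight S p.
Let lg : fps R := log_weight S p.

Let p0 : 0 < p. Proof. by have /andP[] := smallest_root_itv hS hp. Qed.
Let p1 : p < 1. Proof. by have /andP[] := smallest_root_itv hS hp. Qed.

(** A radius available before any [q] is chosen: p s is the midpoint of p and 1. *)
Let slack : exists2 s, 1 < s & p * s < 1.
Proof.
exists ((1 + p) / 2 / p); first by rewrite ltr_pdivlMr// mul1r; move: p1; lra.
by rewrite mulrC divfK ?gt_eqF//; move: p1; lra.
Qed.

Lemma mean_gt0 : 0 < binsum 1 sg.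
Proof.
have [s s1 ps] := slack; have s0 : 0 < s by exact: lt_trans s1.
have [k kS k1] := exists_ge2 hS.
apply: (binsum_gt0 (n := k) s1); rewrite ?(ltnW k1)//.
- exact: wsummable_weight.
- by move=> i; exact: weight_ge0.
- by rewrite /sg /weight mem_set// exprn_gt0.
Qed.

Lemma log_mean_gt0 : 0 < binsum 0 lg.
Proof.
have [s s1 ps] := slack; have s0 : 0 < s by exact: lt_trans s1.
have [k kS k1] := exists_ge2 hS.
apply: (binsum_gt0 (n := k) s1) => //.
- exact: wsummable_log_weight.
- by move=> i; exact: log_weight_ge0.
- by rewrite /lg /log_weight /weight mem_set// mulr_gt0 ?exprn_gt0// ln_gt0// ltr1n.
Qed.

Lemma series_over_mean : series_over S (fun k => k%:R * p ^+ k) = binsum 1 sg.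
Proof.
rewrite series_over_weight /binsum; congr (limn (series _)).
by apply/funext => k; rewrite bin1.
Qed.

Lemma series_over_log_mean :
  series_over S (fun k => ln k%:R * p ^+ k) = binsum 0 lg.
Proof.
rewrite series_over_weight /binsum; congr (limn (series _)).
by apply/funext => k; rewrite bin0 mul1r.
Qed.

Lemma series_over_mean_log :
  series_over S (fun k => k%:R * ln k%:R * p ^+ k) = binsum 1 lg.
Proof.
rewrite series_over_weight /binsum; congr (limn (series _)).
by apply/funext => k; rewrite bin1 mulrA.
Qed.

(** From k^2 = 2 C(k, 2) + C(k, 1). *)
Lemma series_over_second_moment :
  series_over S (fun k => k%:R ^+ 2 * p ^+ k) = binsum 2 sg *+ 2 + binsum 1 sg.
Proof.
have [s s1 ps] := slack; have s0 : 0 < s by exact: lt_trans s1.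
have ssg := wsummable_weight S p0 s0 ps.
rewrite series_over_weight -/sg.
have -> : series (fun k => k%:R ^+ 2 * sg k) =
    (fun n => 2 * series (fun k => 'C(k, 2)%:R * sg k) n +
              series (fun k => 'C(k, 1)%:R * sg k) n).
  apply/funext => n; rewrite /series /= mulr_sumr -big_split /=.
  apply: eq_bigr => k _; rewrite mulrA -mulrDl; congr (_ * _).
  rewrite -natrX -natrM -natrD bin1; congr (_%:R).
  by elim: k => // k; rewrite binS bin1; lia.
apply: (cvg_lim (@Rhausdorff R)); rewrite -(mulr_natl (binsum 2 sg)); apply: cvgD.
  by apply: cvgM; [exact: cvg_cst|exact: (cvg_binsum s1)].
exact: (cvg_binsum s1).
Qed.

Variables (r q : R).
Hypothesis hr : second_root_magnitude S p r.
Hypotheses (pq : p < q) (q1 : q < 1) (qr : q < r).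
Let s := q / p.
Let s1 : 1 < s. Proof. by rewrite ltr_pdivlMr// mul1r. Qed.
Let s0 : 0 < s. Proof. exact: lt_trans s1. Qed.
Let ps : p * s < 1. Proof. by rewrite mulrC divfK// gt_eqF. Qed.
Let D : fps R := 1 - fps_of_poly 'X.

(** Here [r] enters. With t = -geo Q, the product of [Q] and D c is the polynomial -(1 - p X), so D
    c is summable once all roots of [Q] have modulus above [s]. *)
Lemma count_expansion_data : exists2 t : fps R,
  wsummable s t /\ D * t = 1 - sg & wsummable s (D * count_gf S p).
Proof.
have [Spos _ _] := hS.
have [/(f_root_real hS) Pp _] := hp.
have [Q QE tE] := weight_factorization hS Pp.
pose geo : fps R := fun n => p ^+ n.
have sgeo : wsummable s geo := wsummable_geometric s0 (ltW p0) ps.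
have sQ := wsummable_poly s0 Q.
pose t := - (geo * fps_of_poly Q).
have Dt : D * t = 1 - sg := tE.
have st : wsummable s t by apply/(wsummableN s0)/wsummableM.
exists t => //.
(* A double root at [1] would make the mean [sum t = binsum 1 sg] vanish. *)
have Q1 : Q.[1] != 0.
  apply/negP => /factor_theorem[Q2 Q2E].
  pose v := - (geo * fps_of_poly Q2).
  have sv : wsummable s v.
    by apply/(wsummableN s0)/wsummableM => //; exact: wsummable_poly.
  have Dv : (1 - fps_of_poly 'X) * v = fps_of_poly 0%:P - t.
    rewrite polyC0 rmorph0 /t /v Q2E polyC1 rmorphM rmorphB rmorph1 /=; ring.
  have /esym := binsum_diff0 s1 st sv Dv.
  have -> : binsum 0 t = binsum 1 sg.
    apply: (binsum_diff s1 0 (a := 1) (wsummable_weight S p0 s0 ps) st).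
    by rewrite polyC1 rmorph1.
  by apply/eqP; rewrite gt_eqF// mean_gt0.
apply: (@wsummable_divpoly_real R s Q) => //.
- by apply: contraNneq Q1 => ->; rewrite horner0.
(* A root z of [Q] gives a root p z of f, distinct from [p] because Q(1) is nonzero; hence |p z| >=
   r > q = p s. *)
- move=> z Qz; have [_ rmin] := hr.
  have z1 : p%:C * z != p%:C.
    apply: contraNneq Q1 => pz.
    have zE : z = 1%:C.
      by apply: (mulfI (_ : p%:C != 0)); rewrite ?mulr1// (inj_eq (@complexI R) p 0) gt_eqF.
    move: Qz; rewrite zE /root horner_map /= => /eqP/complexI ->.
    by rewrite eqxx.
  have : f_root S (p%:C * z).
    apply: root_scaled_gap_poly => //.
    by rewrite QE rmorphM /= rootM Qz.
  move=> /rmin/(_ z1); rewrite normrM normC_real (gtr0_norm p0) => rpz.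
  rewrite -(ltr_pM2l (_ : 0 < p%:C)) ?ltcR//.
  apply: lt_le_trans rpz; rewrite -rmorphM /= ltcR mulrC divfK// gt_eqF//.
- have -> : fps_of_poly Q * (D * count_gf S p) = fps_of_poly (- (1 - p *: 'X)).
    have H : t * (D * count_gf S p) = 1.
      by rewrite mulrA [t * D]mulrC Dt count_gfE.
    rewrite rmorphN rmorphB rmorph1 /= -[RHS]mulr1 -{2}H /t.
    have xg := fps_geometric p; rewrite -/geo in xg.
    rewrite -[LHS]mul1r -{1}xg; ring.
  exact: wsummable_poly.
Qed.

(** The expectation is b_n / c_n with c_n near 1/m. Subtracting the linear term leaves (w_n - (a1 n
    + a0) w'_n) / c_n, and the factor n of the error comes from a1 n w'_n. *)
Lemma expectation_bigO :
  let L := binsum 0 lg in let L' := binsum 1 lg in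
  let m := binsum 1 sg in let m2 := binsum 2 sg *+ 2 + binsum 1 sg in
  (fun n : nat => uniform_expectation (compositions S n)
              (fun l => ln (part_product l)%:R : R)) =
  (fun n : nat => L / m * n%:R + (L * m2 / m ^+ 2 - L' / m))
    +O_\oo (fun n : nat => n%:R * (p / q) ^+ n : R).
Proof.
move=> L L' m m2; have [Spos _ _] := hS.
have m0 : 0 < m := mean_gt0.
have [t [st Dt] sh] := count_expansion_data.
have [w [w' [sw sw' cE bE]]] := renewal_expansion s1 (wsummable_weight S p0 s0 ps) st
  (wsummable_log_weight hS p0 s0 ps) sh Dt (count_gfE Spos p) (log_product_gfE Spos p)
  (lt0r_neq0 m0).
move: cE bE; rewrite -/sg -/lg -/m -/L -/L' => cE bE.
set a1 := L / m; set a0 := L * m2 / m ^+ 2 - L' / m.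
(* The main terms cancel exactly: the extra [binsum 1 sg] in [m2] accounts for n + 1 in place of
   n. *)
have diffE n : log_product_gf S p n - (a1 * n%:R + a0) * count_gf S p n =
    w n - (a1 * n%:R + a0) * w' n.
  rewrite cE bE /a1 /a0 /m2 -/m -natr1; field; exact: lt0r_neq0.
have [M M0 wM] := wsummable_bound s1 sw.
have [M' M'0 wM'] := wsummable_bound s1 sw'.
have sV : s^-1 = p / q by rewrite invf_div.
(* Keeps the denominator away from 0, at half of its limit 1/m. *)
have near_c : \forall n \near \oo, m^-1 / 2 <= count_gf S p n.
  have w'0 : w' @ \oo --> (0 : R).
    by apply: cvg_series_cvg_0; apply/cvg_ex; exists (binsum 0 w'); exact: (cvg_binsum0 s1).
  have im2 : 0 < m^-1 / 2 by rewrite divr_gt0// invr_gt0.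
  have /cvgr0Pnorm_lt/(_ _ im2) := w'0.
  apply: filterS => n; rewrite cE ltr_norml => /andP[H _].
  by move: H; lra.
apply/eqaddOP.
(* [A] bounds the numerator relative to n (p / q)^n, and the factor 2 m in [B] pays for dividing by
   c_n >= 1 / (2 m). *)
pose A := M + (`|a1| + `|a0|) * M'; pose B := m * 2 * A.
have A0 : 0 <= A by rewrite addr_ge0// mulr_ge0// addr_ge0.
near=> k; near=> n.
have n1 : (1 <= n)%N by near: n; exists 1%N.
have cn : m^-1 / 2 <= count_gf S p n by near: n; exact: near_c.
have kB : B <= k by near: k; apply: nbhs_pinfty_ge; exact: num_real.
have c0 : 0 < count_gf S p n by apply: lt_le_trans cn; rewrite divr_gt0// invr_gt0.
have rho0 : 0 <= (p / q) ^+ n by rewrite exprn_ge0// divr_ge0// ltW// (lt_trans p0).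
have n1R : 1 <= n%:R :> R by rewrite ler1n.
rewrite [X in `|X|](_ : _ = (w n - (a1 * n%:R + a0) * w' n) / count_gf S p n); last first.
  transitivity (log_product_gf S p n / count_gf S p n - (a1 * n%:R + a0)).
    by rewrite -uniform_expectation_gf// gt_eqF.
  by rewrite -diffE mulrBl mulfK// gt_eqF.
rewrite [X in _ <= _ * X]ger0_norm ?mulr_ge0//.
apply: (@le_trans _ _ (B * (n%:R * (p / q) ^+ n))); last first.
  by rewrite ler_wpM2r// mulr_ge0.
rewrite normrM normfV (gtr0_norm c0) ler_pdivrMr//.
apply: (@le_trans _ _ (A * (n%:R * (p / q) ^+ n))); last first.
  rewrite [leRHS]mulrAC ler_wpM2r ?mulr_ge0//.
  suff : A * 1 <= A * (m * 2 * count_gf S p n) by rewrite /B mulr1 mulrCA mulrA.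
  rewrite ler_wpM2l//.
  have : m * 2 * (m^-1 / 2) <= m * 2 * count_gf S p n by rewrite ler_wpM2l// mulr_ge0// ltW.
  by rewrite (_ : m * 2 * (m^-1 / 2) = 1)//; field; exact: lt0r_neq0.
have := wM n; have := wM' n; rewrite sV => w'n wn.
apply: (@le_trans _ _ (`|w n| + `|a1 * n%:R + a0| * `|w' n|)).
  by rewrite -normrM ler_normB.
rewrite mulrDl; apply: lerD.
  by apply: le_trans wn _; rewrite ler_wpM2l// ler_peMl.
rewrite [leRHS](_ : _ = (`|a1| + `|a0|) * n%:R * (M' * (p / q) ^+ n)); last by ring.
apply: ler_pM => //.
  (* Here n >= 1 absorbs |a0| into |a0| n. *)
  apply: le_trans (ler_normD _ _) _; rewrite mulrDl normrM normr_nat lerD2l.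
  by rewrite ler_peMr.
Unshelve. all: by end_near.
Qed.

End Asymptotics.

Theorem theorem6 (R : realType) (S : set nat) (p r : R)
    (hS : proper_cofinite S)
    (hp : smallest_root S p)
    (hr : second_root_magnitude S p r) :
  exists a1 a0 : R,
    [/\ 0 < a1,
        a1 = series_over S (fun k => ln k%:R * p ^+ k) /
             series_over S (fun k => k%:R * p ^+ k),
        a0 = series_over S (fun k => ln k%:R * p ^+ k) *
             series_over S (fun k => k%:R ^+ 2 * p ^+ k) /
             series_over S (fun k => k%:R * p ^+ k) ^+ 2 -
             series_over S (fun k => k%:R * ln k%:R * p ^+ k) /
             series_over S (fun k => k%:R * p ^+ k) &
        forall q : R, p < q -> q < Num.min 1 r ->
          (fun n : nat => uniform_expectation (compositions S n)
                      (fun l => ln (part_product l)%:R : R)) =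
          (fun n : nat => a1 * n%:R + a0)
            +O_\oo (fun n : nat => n%:R * (p / q) ^+ n : R)].
Proof.
rewrite series_over_mean series_over_log_mean series_over_mean_log.
rewrite (series_over_second_moment hS hp).
eexists; eexists; split; [|reflexivity|reflexivity|].
  by rewrite divr_gt0 ?log_mean_gt0 ?mean_gt0.
move=> q pq; rewrite lt_min => /andP[q1 qr].
exact: (expectation_bigO hS hp hr pq q1 qr).
Qed.
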